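(* Let $n \geq 1$, let $K \subset \mathbb{R}^n$ be a compact convex body with smooth boundary and let $L \subset \mathbb{R}^n$ be a lattice of full rank that is virtually rectangular. Then $L$ is isometric to a lattice of the form $CB\mathbb{Z}^n$, where $C$ is a nonsingular real diagonal $n \times n$ matrix and $B$ is a nonsingular integer $n \times n$ matrix with relatively prime entries in each row. Moreover, for such $C$ and $B$, writing $c = c_1 \cdots c_n$ for the product of the diagonal entries $c_1,\dots,c_n$ of $C$, there exist a set $S \subset L$ with $|S| = n+1$ and a translated copy $K' = K+v$ of $K$ (for some $v \in \mathbb{R}^n$) such that $S$ illuminates $K'$ and $$d(S,K') \leq 2 \left[ \frac{ C_n D(K) }{\|L\|} + 1 \right] \frac{\det(L)^n}{|c|^{n-1} \|L\|^{n-1}},$$ where $[\ ]$ denotes the integer part and $$C_n = \frac{ n \sqrt{n} \left( n+2^{n-1} \right)}{\sqrt{2(n+1)}}.$$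
   Context: $\|\cdot\|$ is the Euclidean norm on $\mathbb{R}^n$. A compact convex body is a compact convex subset of $\mathbb{R}^n$ with nonempty interior; $\partial K$ is its boundary and $\mathrm{int}(K)$ its interior. $K$ has smooth boundary if there is a unique support hyperplane to $K$ at each point of $\partial K$. A point $x \in \mathbb{R}^n$ illuminates a point $y \in \partial K$ (with $x \neq y$) if the line segment connecting $x$ and $y$ does not intersect $\mathrm{int}(K)$, but the line containing this segment intersects $\mathrm{int}(K)$. A set $S \subset \mathbb{R}^n$ illuminates $K$ if every $y \in \partial K$ is illuminated by some $x \in S$. For a finite set $S$ that illuminates $K$, the illumination distance is $d(S,K) = \max\{\|x-y\| : x \in S,\ y \in K\}$. The diameter of $K$ is $D(K) = \max\{\|x-y\| : x,y \in K\}$ (invariant under translation). Convention of the source: translated copies of $K$ are identified with $K$, so illuminating $K$ means illuminating some translated copy of $K$; this is written out explicitly in the claim. For a full-rank lattice $L \subset \mathbb{R}^n$, $\det(L)$ is its determinant (the absolute value of the determinant of a basis matrix) and $\|L\| = \min\{\|x\| : x \in L\setminus\{0\}\}$ is its minimal norm. Two full-rank lattices $L, M \subset \mathbb{R}^n$ are isometric if $M = UL$ for some $n \times n$ real orthogonal matrix $U$. A lattice is orthogonal if it has an orthogonal basis, and $L$ is virtually rectangular if it contains a finite-index orthogonal sublattice. *)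

(* Defs.v *)
From mathcomp Require Import all_boot all_order all_algebra.
From mathcomp Require Import all_classical all_reals all_analysis.

Set Implicit Arguments.
Unset Strict Implicit.
Unset Printing Implicit Defensive.

Import Order.TTheory GRing.Theory Num.Theory.
Import numFieldNormedType.Exports.
Local Open Scope classical_set_scope.
Local Open Scope ring_scope.

(* R^n is 'cV[R]_n.  Its library norm `|x| is the sup norm, hence [enorm]; the
   library topology (used for [interior], [closure], [compact]) is the usual
   one. *)

Section Euclidean.
Context {R : realType} {n : nat}.
Implicit Types (x y a : 'cV[R]_n) (K S H : set 'cV[R]_n).

Definition dotv x y : R := \sum_i x i 0 * y i 0.

Definition enorm x : R := Num.sqrt (dotv x x).

Definition boundary K : set 'cV[R]_n := closure K `\` interior K.

Definition convex_body K : Prop :=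
  [/\ compact K, convex_set K & interior K !=set0].

Definition support_hyperplane K x H : Prop :=
  exists a, [/\ a != 0, H = [set y | dotv a y = dotv a x]
              & forall y, K y -> dotv a y <= dotv a x].

Definition smooth_boundary K : Prop :=
  forall x, boundary K x -> exists! H, support_hyperplane K x H.

Definition translate v K : set 'cV[R]_n := [set x + v | x in K].

Definition segment x y : set 'cV[R]_n :=
  [set x + t *: (y - x) | t in [set t : R | 0 <= t <= 1]].

Definition line x y : set 'cV[R]_n :=
  [set x + t *: (y - x) | t in [set: R]].

Definition illuminates_point K x y : Prop :=
  [/\ x != y, segment x y `&` interior K = set0
    & line x y `&` interior K !=set0].

Definition illuminates S K : Prop :=
  forall y, boundary K y -> exists2 x, S x & illuminates_point K x y.

(* The suprema below are maxima when S is finite and K is compact. *)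
Definition illumination_distance S K : R :=
  sup [set r | exists x y, [/\ S x, K y & r = enorm (x - y)]].

Definition diameter K : R :=
  sup [set r | exists x y, [/\ K x, K y & r = enorm (x - y)]].

End Euclidean.

Section Lattices.
Context {R : realType} {n : nat}.
Implicit Types (L M : set 'cV[R]_n).

(* A Z^k, the integer span of the columns of A *)
Definition int_span k (A : 'M[R]_(n, k)) : set 'cV[R]_n :=
  [set A *m map_mx intr z | z in [set: 'cV[int]_k]].

(* row_free A^T: the columns of A are linearly independent. *)
Definition lattice_basis k (A : 'M[R]_(n, k)) L : Prop :=
  row_free A^T /\ L = int_span A.

Definition full_rank_lattice L : Prop :=
  exists A : 'M[R]_n, lattice_basis A L.

(* Independent of the basis chosen by xget, see [lattice_detE]. *)
Definition lattice_det L : R :=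
  `| \det (xget 0 [set A : 'M[R]_n | lattice_basis A L]) |.

(* The infimum is a minimum when L is a lattice and L != {0}. *)
Definition min_norm L : R := inf [set enorm x | x in L `\ 0].

Definition orthogonal_mx (U : 'M[R]_n) : Prop := U^T *m U = 1%:M.

Definition isometric L M : Prop :=
  exists2 U : 'M[R]_n, orthogonal_mx U & M = [set U *m x | x in L].

Definition orthogonal_lattice L : Prop :=
  exists k (A : 'M[R]_(n, k)), lattice_basis A L /\
    forall i j, i != j -> dotv (col i A) (col j A) = 0.

(* M is contained in L and has finitely many cosets in L. *)
Definition finite_index M L : Prop :=
  M `<=` L /\ finite_set [set translate x M | x in L].

Definition virtually_rectangular L : Prop :=
  exists2 M, orthogonal_lattice M & finite_index M L.

Lemma int_span_sub (A A' : 'M[R]_n) : int_span A `<=` int_span A' ->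
  exists P : 'M[int]_n, A = A' *m map_mx intr P.
Proof.
move=> sAA'.
have /choice[p pE] : forall j, exists z : 'cV[int]_n,
    col j A = A' *m map_mx intr z.
  move=> j; have /sAA'[z _ <-] : int_span A (col j A); last by exists z.
  exists (delta_mx j 0) => //.
  by rewrite map_delta_mx colE.
exists (\matrix_(i, j) p j i 0); apply/matrixP => i j.
have /matrixP/(_ i 0) := pE j; rewrite !mxE => ->.
by apply: eq_bigr => k _; rewrite !mxE.
Qed.

Lemma lattice_detE (A : 'M[R]_n) L : lattice_basis A L ->
  lattice_det L = `|\det A|.
Proof.
move=> bA; rewrite /lattice_det; case: xgetP => [A' _ [fA' LA']|/(_ A)//].
have [fA LA] := bA.
have uA : A \in unitmx by rewrite -unitmx_tr -row_free_unit.
have [|P PE] := @int_span_sub A A'; first by rewrite -LA -LA'.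
have [|Q QE] := @int_span_sub A' A; first by rewrite -LA -LA'.
have dA : \det A = \det A * (\det Q * \det P)%:~R.
  by rewrite {1}PE QE !det_mulmx !det_map_mx rmorphM/= mulrA.
have nA : \det A != 0 by rewrite -unitfE -unitmxE.
have QP1 : \det Q * \det P = 1.
  apply/eqP; rewrite -(eqr_int R); apply/eqP.
  by apply: (mulfI nA); rewrite mulr1 -dA.
have : `|\det Q| = 1.
  have : (`|\det Q| * `|\det P|)%N = 1%N by rewrite -abszM QP1.
  by move/eqP; rewrite muln_eq1 => /andP[/eqP q1 _]; rewrite -abszE q1.
by rewrite QE det_mulmx det_map_mx normrM -intr_norm => ->; rewrite mulr1.
Qed.

End Lattices.

Definition primitive_rows n (B : 'M[int]_n) : Prop :=
  forall i, \big[gcdn/0%N]_j `|B i j|%N = 1%N.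

Definition simplex_const (R : realType) (n : nat) : R :=
  n%:R * Num.sqrt n%:R * (n%:R + 2 ^+ n.-1) / Num.sqrt (2 * (n%:R + 1)).

(* Main.v *)
(* For smooth [K], a finite set illuminates [K + v] as soon as every linear
   functional takes a larger value at some point of the set than on [K + v], so
   it suffices to place [K + v] inside an open simplex with vertices in [L].
   Up to rotation [L = C B Z^n], which contains [c_i (det B) e_i] for each [i].
   With [m] the integer part in the bound, the simplex with vertices 0 and
   [m |c_i det B| e_i] contains the cube of side [m ||L|| / n > D(K)] with a
   corner at 0, hence a copy of [K]; and [|c_j det B| >= ||L||] for [j <> i]
   bounds its [i]-th edge by [m det(L)^n / (|c| ||L||)^(n-1)].
   For the decomposition, multiply a basis of [L] by an integer [N] taking it
   into an orthogonal sublattice, rotate the orthogonal basis to the axes, and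
   extract the gcd of each row of the resulting integer matrix. *)
Require Import Defs.
From mathcomp Require Import all_boot all_order all_algebra.
From mathcomp Require Import all_classical all_reals all_analysis.
From mathcomp Require Import ring lra.
Import Order.TTheory GRing.Theory Num.Theory.
Import numFieldNormedType.Exports.
Local Open Scope classical_set_scope.
Local Open Scope ring_scope.

Section Geometry.
Context {R : realType} {n : nat}.
Implicit Types (x y z a d : 'cV[R]_n) (K S : set 'cV[R]_n) (U : 'M[R]_n).

(** * Euclidean inner product and norm *)

Lemma dotvE x y : dotv x y = (x^T *m y) 0 0.
Proof. by rewrite mxE; apply: eq_bigr => i _; rewrite mxE. Qed.

Lemma dotvC x y : dotv x y = dotv y x.
Proof. by apply: eq_bigr => i _; rewrite mulrC. Qed.

Lemma dotvDr a x y : dotv a (x + y) = dotv a x + dotv a y.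
Proof. by rewrite !dotvE mulmxDr mxE. Qed.

Lemma dotvNr a x : dotv a (- x) = - dotv a x.
Proof. by rewrite !dotvE mulmxN mxE. Qed.

Lemma dotvBr a x y : dotv a (x - y) = dotv a x - dotv a y.
Proof. by rewrite dotvDr dotvNr. Qed.

Lemma dotvZr a k x : dotv a (k *: x) = k * dotv a x.
Proof. by rewrite !dotvE -scalemxAr mxE. Qed.

Lemma dotv_ge0 x : 0 <= dotv x x.
Proof. by apply: sumr_ge0 => i _; rewrite -expr2 sqr_ge0. Qed.

Lemma dotv_eq0 x : (dotv x x == 0) = (x == 0).
Proof.
rewrite psumr_eq0; last by move=> i _; rewrite -expr2 sqr_ge0.
apply/allP/eqP => [x0|-> i _]; last by rewrite mxE mul0r eqxx.
apply/matrixP => i j; rewrite ord1 mxE; apply/eqP.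
by have := x0 i (mem_index_enum _); rewrite mulf_eq0 orbb.
Qed.

Lemma dotv_gt0 x : x != 0 -> 0 < dotv x x.
Proof. by rewrite lt_def dotv_ge0 dotv_eq0 andbT. Qed.

Lemma dotv_mulmx U x y : dotv (U *m x) y = dotv x (U^T *m y).
Proof. by rewrite !dotvE trmx_mul mulmxA. Qed.

Lemma dotv_orthogonal U x y : orthogonal_mx U ->
  dotv (U *m x) (U *m y) = dotv x y.
Proof. by move=> UU; rewrite dotv_mulmx mulmxA UU mul1mx. Qed.

Lemma orthogonal_trmx U : orthogonal_mx U -> orthogonal_mx U^T.
Proof. by rewrite /orthogonal_mx trmxK => /mulmx1C. Qed.

Lemma enorm_orthogonal U x : orthogonal_mx U -> enorm (U *m x) = enorm x.
Proof. by move=> UU; rewrite /enorm dotv_orthogonal. Qed.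

Lemma enorm_coord x i : `|x i 0| <= enorm x.
Proof.
rewrite -sqrtr_sqr ler_wsqrtr // /dotv (bigD1 i)//= -expr2 lerDl.
by apply: sumr_ge0 => j _; rewrite -expr2 sqr_ge0.
Qed.

Lemma enorm0 : enorm (0 : 'cV[R]_n) = 0.
Proof.
by rewrite /enorm /dotv big1 ?sqrtr0// => i _; rewrite mxE mul0r.
Qed.

Lemma enorm_gt0 x : x != 0 -> 0 < enorm x.
Proof. by move=> x0; rewrite sqrtr_gt0 dotv_gt0. Qed.

Lemma enorm_le_sum x : enorm x <= \sum_i `|x i 0|.
Proof.
have s0 : 0 <= \sum_i `|x i 0| by apply: sumr_ge0.
rewrite -[leRHS]ger0_norm// -sqrtr_sqr ler_wsqrtr// expr2 /dotv.
rewrite [leRHS]mulr_suml; apply: ler_sum => i _; rewrite -expr2.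
rewrite -(real_normK (num_real (x i 0))).
rewrite expr2 ler_wpM2l// (bigD1 i)//= lerDl.
by apply: sumr_ge0.
Qed.

(** * Support functionals and illumination of smooth bodies *)

Lemma interior_ray K z d : interior K z ->
  exists2 e : R, 0 < e & forall t, 0 <= t <= e -> K (z + t *: d).
Proof.
rewrite /interior/= -nbhs_ballE => -[e/= e0 zK].
have d0 : 0 < `|d| + 1 by rewrite ltr_wpDl.
exists (e / 2 / (`|d| + 1)); first by rewrite !divr_gt0.
move=> t /andP[t0 te]; apply: zK; rewrite -ball_normE/=.
rewrite opprD addrA subrr sub0r normrN normrZ ger0_norm//.
move: te; rewrite ler_pdivlMr// => te.
by have := normr_ge0 d; nra.
Qed.

Lemma interior_dotv_lt K a z (r : R) : a != 0 -> interior K z ->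
  (forall x, K x -> dotv a x <= r) -> dotv a z < r.
Proof.
move=> /dotv_gt0 a0 /(interior_ray K z a)[e e0 zK] Kr.
have /Kr : K (z + e *: a) by apply: zK; rewrite lexx ltW.
by rewrite dotvDr dotvZr; apply: lt_le_trans; rewrite ltrDl mulr_gt0.
Qed.

Lemma cV_closed K : compact K -> closed K.
Proof. by move=> cK; apply: compact_closed => //; exact: norm_hausdorff. Qed.

Lemma supporting_functional K p q : closed K -> smooth_boundary K ->
  interior K p -> ~ interior K q ->
  exists2 a, a != 0 & forall x, K x -> dotv a x <= dotv a q.
Proof.
move=> cK sK Kp Kq.
have supp b : boundary K b ->
    exists2 a, a != 0 & forall x, K x -> dotv a x <= dotv a b.
  by move=> /sK[H [[a [a0 _ aK]] _]]; exists a.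
have [qK|nqK] := pselect (K q).
  by apply: supp; split => //; exact: subset_closure.
pose g (t : R) := p + t *: (q - p).
have gc : continuous g.
  by move=> t; apply: cvgD; [exact: cvg_cst|exact: scalel_continuous].
pose T := [set t : R | t <= 1 /\ K (g t)].
have T0 : T 0.
  by split => //; rewrite /g scale0r addr0; exact: interior_subset.
have Tub : has_ubound T by exists 1 => t [].
have cT : closed T.
  apply: closedI; first exact: closed_le.
  by apply: closed_comp => // t _; exact: gc.
have Tne : T !=set0 by exists 0.
have := closure_sup Tne Tub.
rewrite (_ : closure T = T); last by symmetry; apply/closure_id.
set s := sup T => -[s1 Ks].
have s0 : 0 <= s by apply: ub_le_sup.
have {}s1 : s < 1.
  rewrite lt_neqAle s1 andbT; apply/eqP => sE.
  by apply: nqK; move: Ks; rewrite /g sE scale1r addrC subrK.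
have bs : boundary K (g s).
  split; first exact: subset_closure.
  move=> /(interior_ray _ _ (q - p))[e e0 gK].
  pose m := Num.min e (1 - s).
  have m0 : 0 < m by rewrite lt_min e0 subr_gt0.
  have : T (s + m).
    split; first by rewrite -lerBrDl ge_min lexx orbT.
    rewrite /g scalerDl addrA; apply: gK.
    by rewrite ltW//= ge_min lexx.
  by move=> /(ub_le_sup Tub); rewrite -/s gerDl leNgt m0.
have [a a0 aK] := supp _ bs; exists a => // x /aK /le_trans; apply.
have := interior_dotv_lt K a p _ a0 Kp aK.
by rewrite /g dotvDr dotvZr dotvBr => h; nra.
Qed.

(** Functionals are row vectors here, the form in which [bounded_closed_compact] makes the unit
    sphere compact below. *)
Lemma continuous_dotv_tr x : continuous (fun a : 'rV[R]_n => dotv a^T x).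
Proof.
move=> a; apply: (@cvg_big _ _ _ _ _ _ _ (nbhs a)) => [|i _].
  exact: add_continuous.
rewrite mxE; under eq_fun do rewrite mxE.
by apply: cvgM; [exact: coord_continuous|exact: cvg_cst].
Qed.

(* The normals bounding [K] by [y + t d] form decreasing compact sets as [t]
   decreases to 0; a common element is a normal of [K] at [y]. *)
Lemma normal_along_ray K y d : K y ->
  (forall t : R, 0 < t -> exists2 a, a != 0 &
     forall x, K x -> dotv a x <= dotv a (y + t *: d)) ->
  exists a, [/\ a != 0, 0 <= dotv a d
    & forall x, K x -> dotv a x <= dotv a y].
Proof.
move=> Ky H.
pose A k := [set b : 'rV[R]_n | `|b| = 1 /\ 0 <= dotv b^T d /\
   forall x, K x -> dotv b^T x <= dotv b^T y + k%:R^-1 * dotv b^T d].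
have /choice[b bA] : forall k, exists b, A k.+1 b.
  move=> k; have [|a a0 aK] := H k.+1%:R^-1; first by rewrite invr_gt0.
  have aT0 : 0 < `|a^T|.
    rewrite normr_gt0; apply: contra_neq a0 => a0.
    by rewrite -[a]trmxK a0 trmx0.
  exists (`|a^T|^-1 *: a^T).
  have bE x : dotv (`|a^T|^-1 *: a^T)^T x = `|a^T|^-1 * dotv a x.
    by rewrite linearZ/= trmxK dotvC dotvZr dotvC.
  split; last split.
  - by rewrite normrZ normfV normr_id mulVf// gt_eqF.
  - rewrite bE mulr_ge0 ?invr_ge0//.
    have := aK _ Ky; rewrite dotvDr lerDl dotvZr.
    by rewrite pmulr_rge0 ?invr_gt0.
  move=> x Kx; rewrite !bE mulrCA -mulrDr ler_pM2l ?invr_gt0//.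
  by have := aK _ Kx; rewrite dotvDr dotvZr.
have cS : compact [set b : 'rV[R]_n | `|b| = 1].
  apply: bounded_closed_compact.
    by exists 1; split; [exact: num_real|move=> x x1 c /= ->; exact: ltW].
  apply: (@closed_comp _ _ (fun b : 'rV[R]_n => `|b|) [set 1]).
    by move=> c _; exact: norm_continuous.
  exact: closed_eq.
have [|c [c1 cb]] := cS (b @ \oo) _.
  by exists 0%N => // k _; have [] := bA k.
(* Every neighbourhood of the cluster point [c] meets each tail of [b], so closed conditions that
   hold eventually along [b] pass to [c]. *)
have cl C : closed C -> (\forall k \near \oo, C (b k)) -> C c.
  move=> cC bC; apply: cC => B /(cb _ _ bC).
  by [].
exists c^T; split.
- apply: contra_eq_neq c1 => c0.
  by rewrite -[c]trmxK c0 trmx0 normr0 eq_sym oner_eq0.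
- apply: (cl [set b : 'rV[R]_n | 0 <= dotv b^T d]).
    apply: (@closed_comp _ _ (fun b : 'rV[R]_n => dotv b^T d) [set r | 0 <= r]).
      by move=> ? _; exact: continuous_dotv_tr.
    exact: closed_ge.
  by exists 0%N => // k _; have [_ []] := bA k.
move=> x Kx; apply/ler_addgt0Pr => e e0.
(* [dotv c d] is bounded along the tail by [dotv c d + 1], so that the slack
   [dotv (b k) d / k] vanishes. *)
have dcb : \forall k \near \oo, k.+1%:R^-1 * (dotv c^T d + 1) <= e.
  exists (Num.truncn ((dotv c^T d + 1) / e)) => // k /= hk.
  rewrite mulrC ler_pdivrMr// mulrC -ler_pdivrMr//.
  by apply: (le_trans (ltW (truncnS_gt _))); rewrite ler_nat ltnS.
have nc : nbhs c [set b : 'rV[R]_n | dotv b^T d < dotv c^T d + 1].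
  apply: (continuous_dotv_tr d c [set r | r < dotv c^T d + 1]).
  apply: open_nbhs_nbhs.
  by split; [exact: open_lt|rewrite /= ltrDl].
have cK : closed [set b : 'rV[R]_n | dotv b^T (x - y) <= e].
  apply: (@closed_comp _ _ (fun b : 'rV[R]_n => dotv b^T (x - y))
            [set r | r <= e]).
    by move=> ? _; exact: continuous_dotv_tr.
  exact: closed_le.
suff : dotv c^T (x - y) <= e by rewrite dotvBr lerBlDl.
apply: cK => B Bc.
(* A cluster point yields a vector of the tail but no index, so [E] carries along an index [k] that
   is already large enough. *)
pose E := [set b' | exists2 k,
  k.+1%:R^-1 * (dotv c^T d + 1) <= e & A k.+1 b'].
have bE : (b @ \oo) E.
  by case: dcb => N _ dcb; exists N => // k /dcb ke; exists k.
have [b' [[k ke [_ [_ /(_ _ Kx) b'x]]] [Bb' b'd]]] := cb _ _ bE (filterI Bc nc).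
exists b'; split => //=; rewrite dotvBr lerBlDl (le_trans b'x)// lerD2l.
apply: le_trans ke; rewrite ler_pM2l ?invr_gt0//; exact: ltW.
Qed.

(** Let [a] be the normal at [y] and [s] a point of [S] beyond [K] in direction [a]. On the segment
    from [s] to [y], [dotv a] is at least its maximum on [K], so the interior is missed. If the ray
    from [y] away from [s] missed it too, a limit of functionals would give a normal [b] at [y] with
    [dotv b (y - s) >= 0]; by uniqueness [b] has the hyperplane of [a], which contradicts
    [dotv a y < dotv a s]. *)
Lemma smooth_illuminates K S : compact K -> interior K !=set0 ->
  smooth_boundary K ->
  (forall a, a != 0 -> exists2 s, S s & forall x, K x -> dotv a x < dotv a s) ->
  illuminates S K.
Proof.
move=> /cV_closed cK [p Kp] sK KS y bKy.
have Ky : K y by rewrite (closure_id K).1//; case: bKy.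
have [H [[a [a0 HE aK]] Huniq]] := sK _ bKy.
have [s Ss Ks] := KS a a0; have ays := Ks _ Ky.
exists s => //; split.
- by apply: contra_ltN ays => /eqP ->.
- apply/seteqP; split => // z [[t /= /andP[t0 t1] <-]] Kz.
  have := interior_dotv_lt K a _ _ a0 Kz aK.
  by rewrite dotvDr dotvZr dotvBr; nra.
have [[t t0 Kt]|noK] := pselect (exists2 t : R, 0 < t &
    interior K (y + t *: (y - s))).
  exists (y + t *: (y - s)); split => //; exists (1 + t) => //.
  by rewrite scalerDl scale1r addrA [s + _]addrC subrK.
have [|b [b0 bd bK]] := normal_along_ray K y (y - s) Ky.
  move=> t t0; apply: supporting_functional Kp _ => // Kt.
  by apply: noK; exists t.
have HbE : H = [set z | dotv b z = dotv b y].
  by apply: Huniq; exists b.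
have ap := interior_dotv_lt K a p _ a0 Kp aK.
have bp := interior_dotv_lt K b p _ b0 Kp bK.
pose u := p - y.
(* [b] vanishes on this combination, so [y + e] lies in the common hyperplane and [dotv a e = 0];
   yet [dotv a e] is a negative term plus a nonpositive one. *)
pose e := - dotv b u *: (y - s) + dotv b (y - s) *: u.
have : H (y + e).
  by rewrite HbE /= /e /u !(dotvDr, dotvZr, dotvNr); ring.
rewrite HE /= /e /u !(dotvDr, dotvZr, dotvNr).
move: bd; rewrite dotvBr => bd h.
have h1 : 0 < (dotv b y - dotv b p) * (dotv a s - dotv a y).
  by rewrite mulr_gt0// subr_gt0.
have h2 : 0 <= (dotv b y - dotv b s) * (dotv a y - dotv a p).
  by rewrite mulr_ge0// subr_ge0 ltW.
by exfalso; clear -h h1 h2; lra.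
Qed.

(** * Translates of a body and their illumination *)

Lemma nbhs_translate K v z : nbhs (z - v) K -> nbhs z (translate v K).
Proof.
rewrite -!nbhs_ballE => -[e/= e0 zK]; exists e => //= x zx.
exists (x - v); last by rewrite subrK.
apply: zK; move: zx; rewrite -!ball_normE/=.
by rewrite opprB addrA subrK.
Qed.

Lemma translateN v K : translate (- v) (translate v K) = K.
Proof.
apply/seteqP; split=> [_ [_ [x Kx <-] <-]|x Kx]; first by rewrite addrK.
by exists (x + v); [exists x|rewrite addrK].
Qed.

Lemma interior_translate v K z :
  interior (translate v K) z <-> interior K (z - v).
Proof.
split; rewrite /interior/=; last exact: nbhs_translate.
move=> zK; rewrite -[K](translateN v); apply: nbhs_translate.
by rewrite opprK subrK.
Qed.

Lemma translateC v K : translate v (~` K) = ~` translate v K.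
Proof.
apply/seteqP; split=> [_ [x nKx <-] [y Ky /addIr yx]|x nx].
  by apply: nKx; rewrite -yx.
by exists (x - v); [move=> Kx; apply: nx; exists (x - v) => //|];
  rewrite subrK.
Qed.

Lemma boundary_translate v K z :
  boundary (translate v K) z -> boundary K (z - v).
Proof.
move=> [cz iz]; split; last by move=> /interior_translate.
have clE (A : set 'cV[R]_n) : closure A = ~` interior (~` A).
  by rewrite -closure_setC setCK.
move: cz; rewrite !clE -translateC => h Kz.
by apply: h; apply/interior_translate.
Qed.

Lemma illuminates_translate v S K :
  illuminates [set x - v | x in S] K -> illuminates S (translate v K).
Proof.
move=> SK y /boundary_translate/SK[_ [s Ss <-] [sy seg lin]].
have lineE t : s - v + t *: (y - v - (s - v)) = s + t *: (y - s) - v.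
  by rewrite opprB addrA subrK addrAC.
exists s => //; split.
- by apply: contra_neq sy => ->.
- apply/seteqP; split => // z [[t t01 <-]] /interior_translate.
  rewrite -lineE => Kz.
  by have /seteqP[+ _] := seg => /(_ _ (conj (ex_intro2 _ _ t t01 erefl) Kz)).
have [z [[t _ <-]]] := lin.
rewrite lineE => /interior_translate Kz.
by exists (s + t *: (y - s)); split => //; exists t.
Qed.

(** * Right-angled simplices in rotated axes *)

(** Index 0 matches no [i.+1] and gives the origin, so the vertices are indexed by the naturals up
    to [n]; [U^T] undoes the isometry [U]. *)
Definition simplex_vertex U (s : 'I_n -> R) (k : nat) : 'cV[R]_n :=
  U^T *m \col_i (if k == i.+1 then s i else 0).

Lemma simplex_vertex_mulmx U s k : orthogonal_mx U ->
  U *m simplex_vertex U s k = \col_i (if k == i.+1 then s i else 0).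
Proof. by move=> /mulmx1C UU; rewrite mulmxA UU mul1mx. Qed.

Lemma dotv_simplex_vertex0 U s a : dotv a (simplex_vertex U s 0) = 0.
Proof.
rewrite /simplex_vertex dotvC dotv_mulmx /dotv big1// => i _.
by rewrite mxE/= mul0r.
Qed.

Lemma dotv_simplex_vertexS U s a (i : 'I_n) :
  dotv a (simplex_vertex U s i.+1) = (U *m a) i 0 * s i.
Proof.
rewrite /simplex_vertex dotvC dotv_mulmx trmxK /dotv (bigD1 i)//= big1.
  by rewrite mxE eqxx addr0 mulrC.
move=> j ji; rewrite mxE eqSS.
case: eqP => [/val_inj ij|_]; last by rewrite mul0r.
by rewrite ij eqxx in ji.
Qed.

Lemma simplex_vertex_inj U s : orthogonal_mx U -> (forall i, 0 < s i) ->
  {in `I_n.+1 &, injective (simplex_vertex U s)}.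
Proof.
move=> UU s0 k l; rewrite !inE /= => kn ln kl.
have {}kl (i : 'I_n) : (k == i.+1) = (l == i.+1).
  have /matrixP/(_ i 0) := congr1 (mulmx U) kl.
  rewrite !simplex_vertex_mulmx// !mxE.
  by do 2 case: ifP => // _; move/eqP; rewrite ?[0 == _]eq_sym gt_eqF.
case: k => [|k] in kn kl *; last first.
  by have := kl (Ordinal (kn : (k < n)%N)); rewrite eqxx => /esym/eqP.
case: l => [|l] in ln kl * => //.
by have := kl (Ordinal (ln : (l < n)%N)); rewrite eqxx => /eqP.
Qed.

(* The strict barycentric coordinates of [x] in the simplex bound [dotv a x] by
   the largest value of [dotv a] at a vertex. *)
Lemma simplex_dotv_lt U s a : orthogonal_mx U -> (forall i, 0 < s i) ->
  a != 0 -> exists2 k, (k <= n)%N &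
    forall x, (forall i, 0 < (U *m x) i 0) ->
      \sum_i (U *m x) i 0 / s i < 1 ->
      dotv a x < dotv a (simplex_vertex U s k).
Proof.
move=> UU s0 a0; pose al i := (U *m a) i 0.
have aE x : dotv a x = \sum_i al i * (U *m x) i 0.
  by rewrite -(dotv_orthogonal U)//.
have [i al0] : exists i, al i != 0.
  apply: contra_notP (negP a0) => al0; rewrite -[a]mul1mx -UU -mulmxA.
  rewrite (_ : U *m a = 0) ?mulmx0//.
  apply/matrixP => i j; rewrite ord1 [RHS]mxE; apply/eqP/negPn/negP => ali.
  by apply: al0; exists i.
(* If no coordinate of [U *m a] is positive, the origin is the best vertex, and the nonzero [al i]
   makes the inequality strict. *)
have [[j alj]|nal] := pselect (exists j, 0 < al j); last first.
  exists 0%N => // x x0 _; rewrite dotv_simplex_vertex0 aE.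
  have al_le j : al j <= 0.
    by rewrite leNgt; apply/negP => ?; apply: nal; exists j.
  rewrite -oppr_gt0 -sumrN (bigD1 i)//= ltr_pwDl//.
    by rewrite -mulNr mulr_gt0// oppr_gt0 lt_neqAle al0 al_le.
  by apply: sumr_ge0 => l _; rewrite -mulNr mulr_ge0 ?oppr_ge0// ltW.
have [m _ mM] := @arg_maxP _ _ _ j xpredT (fun l => al l * s l) isT.
have M0 : 0 < al m * s m by apply: lt_le_trans (mM j isT); rewrite mulr_gt0.
exists m.+1 => // x x0 x1; rewrite dotv_simplex_vertexS aE -/(al m).
apply: (@le_lt_trans _ _ (al m * s m * \sum_i (U *m x) i 0 / s i)).
  rewrite mulr_sumr; apply: ler_sum => l _.
  rewrite mulrA ler_pdivlMr// mulrAC.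
  by apply: ler_wpM2r; [exact: ltW|exact: mM].
by rewrite gtr_pMr.
Qed.

Lemma coord_le_norm x i : `|x i 0| <= `|x|.
Proof.
rewrite [leRHS](_ : _ = mx_norm x)// mx_normrE.
exact: (le_bigmax _ (fun ij : 'I_n * 'I_1 => `|x ij.1 ij.2|) (i, 0)).
Qed.

Lemma enorm_sub_le_diameter K x y : compact K -> K x -> K y ->
  enorm (x - y) <= diameter K.
Proof.
move=> /compact_bounded[M [_ KM]] Kx Ky.
apply: ub_le_sup; last by exists x, y.
have {}KM z : K z -> `|z| <= M + 1 by apply: KM; rewrite ltrDl.
exists (\sum_(i < n) (M + 1 + (M + 1))) => _ [u [v [Ku Kv ->]]].
apply: le_trans (enorm_le_sum _) _; apply: ler_sum => i _.
apply: le_trans (coord_le_norm _ _) _; apply: le_trans (ler_normB _ _) _.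
by rewrite lerD// KM.
Qed.

Lemma diameter_ge0 K : compact K -> K !=set0 -> 0 <= diameter K.
Proof.
move=> cK [x Kx]; apply: le_trans (enorm_sub_le_diameter _ x x cK Kx Kx).
exact: sqrtr_ge0.
Qed.

(** In the rotated coordinates [K] has extent at most [diameter K] along each axis. Half of the
    slack [s i / n - diameter K] is left as a gap before each coordinate hyperplane, so every
    coordinate lies strictly between 0 and [s i / n], and the [n] ratios sum to less than 1. *)
Lemma translate_into_simplex K U (s : 'I_n -> R) : (0 < n)%N -> compact K ->
  K !=set0 -> orthogonal_mx U -> (forall i, n%:R * diameter K < s i) ->
  exists v, forall x, translate v K x ->
    (forall i, 0 < (U *m x) i 0) /\ \sum_i (U *m x) i 0 / s i < 1.
Proof.
move=> n0 cK K0 UU Ks; have nR0 : 0 < n%:R :> R by rewrite ltr0n.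
pose lo i := inf [set (U *m x) i 0 | x in K].
pose e i := (s i / n%:R - diameter K) / 2.
have D0 := diameter_ge0 _ cK K0.
have e0 i : 0 < e i by rewrite divr_gt0// subr_gt0 ltr_pdivlMr// mulrC.
have s0 i : 0 < s i by apply: le_lt_trans (Ks i); rewrite mulr_ge0// ltW.
have coordB i x y : K x -> K y -> (U *m x) i 0 - diameter K <= (U *m y) i 0.
  move=> Kx Ky; have := enorm_sub_le_diameter _ _ _ cK Kx Ky.
  rewrite -(enorm_orthogonal U)// => /(le_trans (enorm_coord _ i)).
  rewrite mulmxBr mxE [X in `|_ + X|]mxE.
  by move=> /(le_trans (ler_norm _)); lra.
have lo_le i x : K x -> lo i <= (U *m x) i 0.
  move=> Kx; apply: ge_inf; last by exists x.
  by exists ((U *m x) i 0 - diameter K) => _ [y Ky <-]; exact: coordB.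
have le_lo i x : K x -> (U *m x) i 0 - diameter K <= lo i.
  move=> Kx; apply: lb_le_inf; first by exists ((U *m x) i 0), x.
  by move=> _ [y Ky <-]; exact: coordB.
exists (U^T *m \col_i (e i - lo i)) => _ [x Kx <-].
have UxE i : (U *m (x + U^T *m \col_i (e i - lo i))) i 0 =
    (U *m x) i 0 + (e i - lo i).
  by rewrite mulmxDr mulmxA (mulmx1C UU) mul1mx mxE [X in _ + X]mxE.
split=> [i|]; first by rewrite UxE; have := lo_le i x Kx; have := e0 i; lra.
rewrite [ltRHS](_ : _ = \sum_(i < n) n%:R^-1).
  apply: ltr_sum => [|i _]; first by apply/hasP; exists (Ordinal n0).
  rewrite ltr_pdivrMr// UxE mulrC.
  have := le_lo i x Kx; have := e0 i; rewrite /e; lra.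
by rewrite sumr_const card_ord -[RHS]mulr_natl divff ?gt_eqF.
Qed.

(** In the rotated frame both points have coordinate sum at most [M]: the vertex has at most one
    nonzero coordinate, and a coordinate [t] of the other point is at most [M * (t / s i)]. *)
Lemma simplex_vertex_dist U (s : 'I_n -> R) (M : R) x k : orthogonal_mx U ->
  0 <= M -> (forall i, 0 < s i <= M) -> (forall i, 0 < (U *m x) i 0) ->
  \sum_i (U *m x) i 0 / s i < 1 ->
  enorm (simplex_vertex U s k - x) <= 2 * M.
Proof.
move=> UU M0 sM x0 x1; rewrite -(enorm_orthogonal U)// mulmxBr.
rewrite simplex_vertex_mulmx//; apply: le_trans (enorm_le_sum _) _.
pose w := \col_i (if k == i.+1 then s i else 0).
have s0 i : 0 < s i by case/andP: (sM i).
have sleM i : s i <= M by case/andP: (sM i).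
have wM : \sum_i w i 0 <= M.
  have [[i ki]|nk] := pselect (exists i : 'I_n, k = i.+1).
    rewrite (bigD1 i)//= big1 => [|j ji]; rewrite mxE ki ?eqxx ?addr0//.
    by rewrite eqSS; case: eqP => // /val_inj ij; rewrite ij eqxx in ji.
  rewrite big1 // => i _; rewrite mxE; case: eqP => // ki.
  by case: nk; exists i.
apply: (@le_trans _ _ (\sum_i (w i 0 + (U *m x) i 0))).
  apply: ler_sum => i _.
  have w0 : 0 <= w i 0 by rewrite mxE; case: ifP => // _; exact: ltW.
  rewrite [X in `|X|]mxE [X in `|_ + X|]mxE.
  by rewrite (le_trans (ler_normB _ _))// !ger0_norm// ltW.
rewrite big_split/= mulr_natl mulr2n lerD//.
apply: (@le_trans _ _ (M * \sum_i (U *m x) i 0 / s i)).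
  rewrite mulr_sumr; apply: ler_sum => i _.
  by rewrite mulrCA ler_peMr ?ler_pdivlMr ?mul1r// ltW.
by rewrite ler_piMr// ltW.
Qed.

End Geometry.
Section Lattices.
Context {R : realType} {n : nat}.
Implicit Types (A C U : 'M[R]_n) (B : 'M[int]_n) (L M : set 'cV[R]_n).

(** * Lattice bases, minimal norm and axis vectors *)

Lemma int_span_mulrn k (A : 'M[R]_(n, k)) x m :
  int_span A x -> int_span A (x *+ m).
Proof.
move=> [z _ <-]; exists (z *+ m) => //.
by rewrite raddfMn/= (raddfMn (mulmx A)).
Qed.

Lemma int_span_mulmx k (A : 'M[R]_(n, k)) (U : 'M[R]_n) :
  int_span (U *m A) = [set U *m x | x in int_span A].
Proof.
apply/seteqP; split => [_ [z _ <-]|_ [_ [z _ <-] <-]].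
  by exists (A *m map_mx intr z); rewrite ?mulmxA//; exists z.
by exists z; rewrite ?mulmxA.
Qed.

Lemma isometric_basis L A :
  isometric L (int_span A) -> A \in unitmx ->
  exists2 U, orthogonal_mx U & lattice_basis (U^T *m A) L.
Proof.
move=> [U UU AE] uA; exists U => //.
have uU : U^T \in unitmx by have [] := mulmx1_unit UU.
split; first by rewrite row_free_unit unitmx_tr unitmx_mul uU.
rewrite int_span_mulmx AE; apply/seteqP; split => [x Lx|_ [_ [x Lx <-] <-]].
  by exists (U *m x); [exists x|rewrite mulmxA UU mul1mx].
by rewrite mulmxA UU mul1mx.
Qed.

Lemma orthogonal_det U : orthogonal_mx U -> `|\det U| = 1.
Proof.
move=> /(congr1 determinant); rewrite det_mulmx det_tr det1 -expr2 => dU.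
by apply/eqP; rewrite -sqrp_eq1// real_normK ?num_real// dU.
Qed.

(** For nonzero [x = A z] some integer coordinate of [z] has absolute value at least 1, while
    [z = invmx A *m x] bounds it by [N * enorm x]. The [+ 1] keeps [N] positive. *)
Lemma min_norm_gt0 A L : (0 < n)%N -> lattice_basis A L -> 0 < min_norm L.
Proof.
move=> n0 [fA ->].
have uA : A \in unitmx by rewrite -unitmx_tr -row_free_unit.
pose N := \sum_i \sum_j `|invmx A i j| + 1.
have N0 : 0 < N.
  by rewrite ltr_wpDl// sumr_ge0// => i _; rewrite sumr_ge0.
apply: (@lt_le_trans _ _ N^-1); first by rewrite invr_gt0.
apply: lb_le_inf.
  pose z : 'cV[int]_n := delta_mx (Ordinal n0) 0.
  exists (enorm (A *m map_mx intr z)), (A *m map_mx intr z) => //.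
  split; first by exists z.
  move=> /= /(congr1 (mulmx (invmx A))); rewrite mulmxA mulVmx// mul1mx mulmx0.
  move/matrixP/(_ (Ordinal n0) 0); rewrite !mxE !eqxx => /eqP.
  by rewrite oner_eq0.
move=> _ [x [[z _ zx] /= x0] <-].
have zE : map_mx intr z = invmx A *m x by rewrite -zx mulmxA mulVmx// mul1mx.
have [i zi] : exists i, z i 0 != 0.
  apply: contra_notP x0 => z0; rewrite -zx (_ : z = 0) ?map_mx0 ?mulmx0//.
  apply/matrixP => i j; rewrite ord1 [RHS]mxE; apply/eqP/negPn/negP => zi.
  by apply: z0; exists i.
rewrite -div1r ler_pdivrMr//.
have : 1 <= `|(z i 0)%:~R| :> R by rewrite -intr_norm ler1z -gtz0_ge1 normr_gt0.
move=> /le_trans; apply.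
have -> : (z i 0)%:~R = (invmx A *m x) i 0 :> R by rewrite -zE mxE.
rewrite mxE; apply: (le_trans (ler_norm_sum _ _ _)).
apply: (@le_trans _ _ (\sum_j enorm x * `|invmx A i j|)).
  apply: ler_sum => j _; rewrite normrM mulrC ler_wpM2r//.
  exact: enorm_coord.
rewrite -mulr_sumr ler_wpM2l ?sqrtr_ge0// /N.
rewrite [X in _ <= X + 1](bigD1 i)//= -addrA lerDl.
by rewrite addr_ge0// sumr_ge0// => k _; rewrite sumr_ge0.
Qed.

Lemma min_norm_le L x : L x -> x != 0 -> min_norm L <= enorm x.
Proof.
move=> Lx /eqP x0; apply: ge_inf; last by exists x.
by exists 0 => _ [y _ <-]; exact: sqrtr_ge0.
Qed.

Lemma enorm_scale_delta (r : R) (i : 'I_n) :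
  enorm (r *: delta_mx i 0 : 'cV[R]_n) = `|r|.
Proof.
rewrite /enorm /dotv (bigD1 i)//= big1 => [|j /negbTE ji].
  by rewrite !mxE !eqxx mulr1 addr0 -expr2 sqrtr_sqr.
by rewrite !mxE ji mulr0 mul0r.
Qed.

(* [B (adj B) = (det B) I] puts the multiples [c_i (det B) e_i] of the standard
   basis into the lattice spanned by [C B]. *)
Lemma int_span_axis C B i (m : int) : is_diag_mx C ->
  int_span (C *m map_mx intr B)
    ((m%:~R * `|(\det B)%:~R * C i i|) *: delta_mx i 0).
Proof.
move=> /diag_mxP[c ->].
(* The factor [sg] turns [det B] times [c_i] into its absolute value while keeping the coefficient
   vector integral. *)
pose sg := sgz ((\det B)%:~R * diag_mx c i i).
exists ((sg * m) *: (\adj B *m delta_mx i 0)) => //.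
rewrite -mulmxA map_mxZ -!scalemxAr -map_mxM mulmxA mul_mx_adj.
rewrite mul_scalar_mx map_mxZ map_delta_mx -scalemxAr scalerA.
rewrite mul_diag_mx.
have -> : `|(\det B)%:~R * diag_mx c i i| = sg%:~R * ((\det B)%:~R * c 0 i).
  by rewrite normrEsg sgrEz -/sg; congr (_ * (_ * _)); rewrite mxE eqxx mulr1n.
apply/matrixP => j k; rewrite !mxE ord1 eqxx andbT rmorphM/=.
by case: eqP => [->|_]; rewrite ?mulr0// !mulr1; ring.
Qed.

(** * From a finite-index orthogonal sublattice to [C] and [B] *)

(** By pigeonhole two multiples of [x] share a coset, and their difference is a positive multiple
    inside the sublattice. *)
Lemma finite_index_mulrn k (A : 'M[R]_(n, k)) L x :
  (forall m, L (x *+ m)) -> finite_index (int_span A) L ->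
  exists2 N, (0 < N)%N & int_span A (x *+ N).
Proof.
move=> Lx [_ fin]; pose f m := translate (x *+ m) (int_span A).
have [i [j [ij fij]]] : exists i j, (i < j)%N /\ f i = f j.
  apply/not_existsP => nf; apply: infinite_nat.
  have fN i j : (i < j)%N -> f i <> f j.
    by move=> ij fij; apply: (nf i); exists j.
  have injf : {in [set: nat] &, injective f}.
    move=> i j _ _ fij; have [ij|ji|//] := ltngtP i j.
      by case: (fN _ _ ij).
    by case: (fN _ _ ji).
  rewrite -(eq_finite_set (inj_card_eq injf)).
  by apply: sub_finite_set fin => _ [m _ <-]; exists (x *+ m).
exists (j - i)%N; first by rewrite subn_gt0.
have : f j (x *+ j).
  by exists 0; rewrite ?add0r//; exists 0 => //; rewrite map_mx0 mulmx0.
rewrite -fij => -[y Ay yx].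
by rewrite mulrnBr 1?ltnW// -yx addrK.
Qed.

(** Each basis column has its own multiplier; the product of these serves all columns at once. *)
Lemma orthogonal_sublattice_integral L A k (M : 'M[R]_(n, k)) :
  lattice_basis A L -> finite_index (int_span M) L ->
  exists2 N : nat, (0 < N)%N &
    exists P : 'M[int]_(k, n), N%:R *: A = M *m map_mx intr P.
Proof.
move=> [_ LE] fin.
have Lcol j m : L (col j A *+ m).
  rewrite LE; apply: int_span_mulrn; exists (delta_mx j 0) => //.
  by rewrite map_delta_mx colE.
have /choice[N NP] j : exists N, (0 < N)%N /\ int_span M (col j A *+ N).
  by have [N N0 ?] := finite_index_mulrn _ _ _ _ (Lcol j) fin; exists N.
have /choice[p pE] j : exists z : 'cV[int]_k,
    col j A *+ (\prod_i N i) = M *m map_mx intr z.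
  have [_ /(int_span_mulrn _ _ _ (\prod_(i | i != j) N i))] := NP j.
  rewrite -mulrnA -(bigD1 j (P := xpredT) (F := N))//=.
  by move=> [z _ <-]; exists z.
exists (\prod_i N i); first by rewrite prodn_gt0// => j; case: (NP j).
exists (\matrix_(i, j) p j i 0); apply/matrixP => i j.
have /matrixP/(_ i 0) := pE j; rewrite -scaler_nat !mxE => ->.
by apply: eq_bigr => l _; rewrite !mxE.
Qed.

(* The Gram matrix of an orthogonal basis is diagonal, so normalising the basis
   gives an orthogonal matrix. *)
Lemma orthogonal_basis_normalize A : A \in unitmx ->
  (forall i j, i != j -> dotv (col i A) (col j A) = 0) ->
  exists2 U, orthogonal_mx U & exists2 r : 'rV[R]_n,
    (forall i, 0 < r 0 i) & U *m A = diag_mx r.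
Proof.
move=> uA oA; pose r := \row_i enorm (col i A).
have r0 i : 0 < r 0 i.
  rewrite mxE; apply: enorm_gt0; apply: contraTneq uA => Ai.
  rewrite -unitmx_tr -row_free_unit; apply/row_freePn; exists i.
  by rewrite -tr_col Ai trmx0 sub0mx.
have gram i j : (A^T *m A) i j = (r 0 i ^+ 2) *+ (i == j).
  have -> : (A^T *m A) i j = dotv (col i A) (col j A).
    by rewrite mxE; apply: eq_bigr => k _; rewrite !mxE.
  case: eqP => [<-|/eqP/oA//]; rewrite mulr1n mxE sqr_sqrtr//; exact: dotv_ge0.
pose U := diag_mx (\row_i (r 0 i)^-1) *m A^T.
have UA : U *m A = diag_mx r.
  apply/matrixP => i j; rewrite -mulmxA mul_diag_mx mxE gram !mxE.
  case: eqP => [_|_]; last by rewrite mulr0n mulr0.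
  by rewrite !mulr1n expr2 mulKf// gt_eqF//; have := r0 i; rewrite mxE.
exists U; last by exists r.
(* [U U^T = (U A) diag(1/r) = 1], which suffices for a square matrix. *)
apply: mulmx1C; rewrite {2}/U trmx_mul trmxK tr_diag_mx mulmxA UA.
apply/matrixP => i j; rewrite mul_diag_mx !mxE.
case: eqP => [->|_]; last by rewrite mulr0n mulr0.
by rewrite !mulr1n mulfV// gt_eqF//; have := r0 j; rewrite mxE.
Qed.

(** Each row is divided by its gcd, which is nonzero because a zero row would make the determinant
    vanish. *)
Lemma primitive_rows_factor B : \det B != 0 ->
  exists2 g : 'I_n -> nat, (forall i, 0 < g i)%N &
    exists2 B' : 'M[int]_n, primitive_rows B' &
      \det B' != 0 /\ forall i j, B i j = (g i)%:Z * B' i j.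
Proof.
move=> dB; pose g i := \big[gcdn/0%N]_j `|B i j|%N.
have gB i j : (g i %| `|B i j|)%N by rewrite (biggcdn_inf j).
have g0 i : (0 < g i)%N.
  rewrite lt0n; apply: contra_neq dB => gi0.
  have Bi0 j : B i j = 0.
    by have := gB i j; rewrite gi0 dvd0n absz_eq0 => /eqP.
  by rewrite (expand_det_row _ i) big1// => j _; rewrite Bi0 mul0r.
pose B' : 'M[int]_n := \matrix_(i, j) (B i j %/ (g i)%:Z)%Z.
have BE i j : B i j = (g i)%:Z * B' i j.
  by rewrite mxE mulrC divzK//; exact: gB.
exists g => //; exists B'.
  move=> i; have : (g i * \big[gcdn/0%N]_j `|B' i j| = g i * 1)%N.
    rewrite (big_morph (muln (g i)) (muln_gcdr (g i)) (muln0 _)) muln1.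
    by apply: eq_bigr => j _; rewrite [in RHS]BE abszM.
  by move/eqP; rewrite eqn_pmul2l// => /eqP.
split=> //; apply: contra_neq dB => dB'.
have -> : B = diag_mx (\row_i (g i)%:Z) *m B'.
  by apply/matrixP => i j; rewrite mul_diag_mx mxE [X in X * _]mxE BE.
by rewrite det_mulmx dB' mulr0.
Qed.

End Lattices.

Lemma virtually_rectangular_decomposition (R : realType) (n : nat)
    (L : set 'cV[R]_n) : full_rank_lattice L -> virtually_rectangular L ->
  exists (C : 'M[R]_n) (B : 'M[int]_n),
    [/\ is_diag_mx C, C \in unitmx, \det B != 0, primitive_rows B
      & isometric L (int_span (C *m map_mx intr B))].
Proof.
move=> [A [fA LE]] [M [k [A' [[fA' ->] oA']]] fin].
have uA : A \in unitmx by rewrite -unitmx_tr -row_free_unit.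
have [N N0 [P NA]] := orthogonal_sublattice_integral _ _ _ _ (conj fA LE) fin.
have NR0 : N%:R != 0 :> R by rewrite pnatr_eq0 -lt0n.
have uNA : N%:R *: A \in unitmx by rewrite unitmxZ ?unitfE.
(* The sublattice comes with [k] generators: independence gives [k <= n], and the rank of the
   invertible [N A = A' P] gives [n <= k]. *)
have kn : k = n.
  apply/eqP; rewrite eqn_leq; apply/andP; split.
    by move: fA'; rewrite /row_free => /eqP <-; exact: rank_leq_col.
  have := mulmx_max_rank A' (map_mx intr P).
  by rewrite -NA mxrank_unit.
subst k.
have uA' : A' \in unitmx by rewrite -unitmx_tr -row_free_unit.
have [U UU [r r0 UA']] := orthogonal_basis_normalize _ uA' oA'.
have dP : \det P != 0.
  move: uNA; rewrite NA unitmx_mul => /andP[_].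
  by rewrite unitmxE det_map_mx unitfE intr_eq0.
have [g g0 [B primB [dB PE]]] := primitive_rows_factor _ dP.
(* From [N A = A' P], [U A' = diag r] and [P = diag g B] follows [U A = diag (r g / N) B], which
   dictates [c]. *)
pose c : 'rV[R]_n := \row_i (r 0 i * (g i)%:R / N%:R).
have c0 i : c 0 i != 0.
  rewrite mxE !mulf_neq0 ?invr_neq0 ?pnatr_eq0 -?lt0n//.
  by rewrite gt_eqF.
exists (diag_mx c), B; split; rewrite ?diag_mx_is_diag//.
  rewrite unitmxE det_diag unitfE prodf_seq_neq0.
  by apply/allP => i _; exact: c0.
exists U => //; rewrite LE -int_span_mulmx; congr int_span.
have := congr1 (mulmx U) NA; rewrite -scalemxAr mulmxA UA' => NUA.
apply: (scalerI NR0); rewrite NUA.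
apply/matrixP => i j; rewrite !mul_diag_mx !mxE PE.
by rewrite intrM; field.
Qed.

(** * The constant and the illumination bound *)

(** This holds by [sqrt (2 (n + 1)) <= n + 1 <= n + 2 ^ (n - 1)] and [sqrt n >= 1]. It lets the
    stated constant make the simplex edges exceed [n * diameter K]. *)
Lemma simplex_const_ge (R : realType) (n : nat) : (0 < n)%N ->
  n%:R <= simplex_const R n.
Proof.
move=> n0; rewrite /simplex_const -!mulrA ler_peMr// mulrA.
have n1 : 1 <= n%:R :> R by rewrite ler1n.
have t0 : 0 < Num.sqrt (2 * (n%:R + 1)) :> R.
  by rewrite sqrtr_gt0 mulr_gt0// ltr_wpDl.
rewrite ler_pdivlMr// mul1r.
have e1 : 1 <= 2 ^+ n.-1 :> R by rewrite exprn_ege1// ler1n.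
have s1 : 1 <= Num.sqrt n%:R :> R by rewrite -[leLHS]sqrtr1 ler_wsqrtr.
apply: (@le_trans _ _ (n%:R + 1)).
  have nn : 0 <= n%:R + 1 :> R by rewrite addr_ge0.
  by rewrite -[leRHS]ger0_norm// -sqrtr_sqr ler_wsqrtr//; nra.
by apply: (@le_trans _ _ (n%:R + 2 ^+ n.-1)); nra.
Qed.

(* [S] consists of 0 and the points [m |c_i det B|] on the rotated coordinate
   axes, where [m] is the integer part in the bound. *)
Lemma lattice_illumination (R : realType) (n : nat) (K L : set 'cV[R]_n)
    (C : 'M[R]_n) (B : 'M[int]_n) : (0 < n)%N ->
  convex_body K -> smooth_boundary K ->
  is_diag_mx C -> C \in unitmx -> \det B != 0 ->
  isometric L (int_span (C *m map_mx intr B)) ->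
  exists (S : set 'cV[R]_n) (v : 'cV[R]_n),
    [/\ S `<=` L, (S #= `I_n.+1)%card, illuminates S (translate v K)
      & illumination_distance S (translate v K) <=
        2 * (Num.floor (simplex_const R n * diameter K / min_norm L + 1))%:~R
          * (lattice_det L ^+ n
             / (`|\prod_i C i i| ^+ n.-1 * min_norm L ^+ n.-1))].
Proof.
move=> n0 [cK _ K0] sK dC uC dB isoL.
set c := \prod_i C i i; set m := Num.floor _; set lam := min_norm L.
have detC : \det C = c by rewrite det_trig// is_diag_mx_is_trig.
have c0 : c != 0 by rewrite -detC -unitfE -unitmxE.
have dBR : (\det B)%:~R != 0 :> R by rewrite intr_eq0.
have uCB : C *m map_mx intr B \in unitmx.
  by rewrite unitmx_mul uC unitmxE det_map_mx unitfE.
have [U UU basL] := isometric_basis _ _ isoL uCB.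
have LE := basL.2.
have UU' := orthogonal_trmx _ UU.
have lam0 : 0 < lam := min_norm_gt0 _ _ n0 basL.
have detL : lattice_det L = `|c| * `|(\det B)%:~R|.
  rewrite (lattice_detE basL) !det_mulmx normrM orthogonal_det// mul1r.
  by rewrite normrM detC det_map_mx.
pose q i := `|(\det B)%:~R * C i i|.
have axisL i (k : int) : L (U^T *m ((k%:~R * q i) *: delta_mx i 0)).
  rewrite LE int_span_mulmx; eexists; last by [].
  exact: int_span_axis.
have q0 i : 0 < q i.
  rewrite normr_gt0 mulf_neq0//; move: c0; rewrite prodf_seq_neq0.
  by move/allP/(_ i (mem_index_enum _)).
have lamq i : lam <= q i.
  have qE : enorm (U^T *m (((1 : int)%:~R * q i) *: delta_mx i 0)) = q i.
    by rewrite enorm_orthogonal// enorm_scale_delta mul1r ger0_norm ?ltW.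
  rewrite -[leRHS]qE; apply: min_norm_le; first exact: axisL.
  apply: contraTneq (q0 i) => x0.
  by move: qE; rewrite x0 enorm0 => <-; rewrite ltxx.
have prodq : \prod_i q i = `|c| * `|(\det B)%:~R| ^+ n.
  rewrite -normr_prod big_split/= normrM mulrC; congr (_ * _).
  by rewrite prodr_const card_ord normrX.
have Kne : K !=set0 by have [p /interior_subset Kp] := K0; exists p.
have D0 := diameter_ge0 _ cK Kne.
(* As the integer part of [X + 1], [m] satisfies [m + 1 > X + 1], hence [m > X], and [X] is at least
   [n * diameter K / lam]. *)
have mlam : n%:R * diameter K < m%:~R * lam.
  rewrite -ltr_pdivrMr//; set X := simplex_const R n * diameter K / lam.
  apply: (@le_lt_trans _ _ X); last first.
    by rewrite -(ltrD2r 1) (lt_le_trans (floorD1_gt _))// intrD.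
  by rewrite ler_pM2r ?invr_gt0// ler_wpM2r// simplex_const_ge.
have m0 : 0 < m%:~R :> R.
  by rewrite -(pmulr_lgt0 _ lam0) (le_lt_trans _ mlam)// mulr_ge0.
pose s i := m%:~R * q i.
have s0 i : 0 < s i by rewrite mulr_gt0.
have Ks i : n%:R * diameter K < s i.
  by apply: lt_le_trans mlam _; rewrite ler_pM2l.
have [v vK] := translate_into_simplex _ _ _ n0 cK Kne UU Ks.
exists (simplex_vertex U s @` `I_n.+1), v; split.
- move=> _ [[|k] kn <-].
    have := axisL (Ordinal n0) 0; rewrite mul0r scale0r; congr (L (_ *m _)).
    by apply/matrixP => i j; rewrite !mxE.
  have := axisL (Ordinal (kn : (k < n)%N)) m; congr (L (_ *m _)).
  apply/matrixP => i j; rewrite !mxE ord1 eqxx andbT eqSS -val_eqE/= eq_sym.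
  case: eqP => [ki|_]; rewrite ?mulr0// mulr1.
  by congr (s _); apply: val_inj; rewrite /= ki.
- by apply: inj_card_eq; exact: simplex_vertex_inj.
(* Smoothness is assumed for [K] itself, so the vertices are shifted by [- v] and compared with [K]
   instead of its translate. *)
- apply: illuminates_translate; apply: smooth_illuminates => // a a0.
  have [k kn ak] := simplex_dotv_lt _ _ _ UU s0 a0.
  exists (simplex_vertex U s k - v).
    by exists (simplex_vertex U s k) => //; exists k.
  move=> x Kx; rewrite dotvBr ltrBrDr -dotvDr.
  have /vK[x0 x1] : translate v K (x + v) by exists x.
  exact: ak.
pose M := m%:~R * (lattice_det L ^+ n / (`|c| ^+ n.-1 * lam ^+ n.-1)).
have c0' : 0 < `|c| by rewrite normr_gt0.
(* [det(L)^n / |c|^(n-1) = |c| |det B|^n] is the product of all [q j]; apart from [q i], its [n - 1]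
   factors are each at least [lam]. *)
have sM i : 0 < s i <= M.
  rewrite s0 ler_pM2l// ler_pdivlMr; last by rewrite mulr_gt0// exprn_gt0.
  have -> : lattice_det L ^+ n =
      `|c| ^+ n.-1 * (`|c| * `|(\det B)%:~R| ^+ n).
    by rewrite detL exprMn mulrA -exprSr prednK.
  rewrite mulrCA.
  rewrite ler_pM2l ?exprn_gt0// -prodq (bigD1 i)//= ler_pM2l//.
  have : \prod_(j < n | j != i) lam <= \prod_(j < n | j != i) q j.
    by apply: ler_prod => j _; rewrite lamq andbT ltW.
  by rewrite prodr_const cardC1 card_ord.
have M0 : 0 <= M by case/andP: (sM (Ordinal n0)) => /ltW/le_trans + sm; apply.
rewrite -mulrA -/M; apply: ge_sup.
  have [x Kx] := Kne.
  exists (enorm (simplex_vertex U s 0 - (x + v))).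
  exists (simplex_vertex U s 0), (x + v).
  by split => //; [exists 0%N|exists x].
move=> _ [_ [y [[k _ <-] /vK[y0 y1] ->]]].
exact: simplex_vertex_dist.
Qed.

Theorem corollary1p5 (R : realType) (n : nat) (K L : set 'cV[R]_n)
    (n_ge1 : (1 <= n)%N)
    (K_body : convex_body K) (K_smooth : smooth_boundary K)
    (L_lattice : full_rank_lattice L) (L_vrect : virtually_rectangular L) :
  (exists (C : 'M[R]_n) (B : 'M[int]_n),
     [/\ is_diag_mx C, C \in unitmx, \det B != 0, primitive_rows B
       & isometric L (int_span (C *m map_mx intr B))]) /\
  (forall (C : 'M[R]_n) (B : 'M[int]_n),
     is_diag_mx C -> C \in unitmx -> \det B != 0 -> primitive_rows B ->
     isometric L (int_span (C *m map_mx intr B)) ->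
     let c := \prod_i C i i in
     exists (S : set 'cV[R]_n) (v : 'cV[R]_n),
       [/\ S `<=` L, (S #= `I_n.+1)%card, illuminates S (translate v K)
         & illumination_distance S (translate v K) <=
           2 * (Num.floor (simplex_const R n * diameter K / min_norm L + 1))%:~R
             * (lattice_det L ^+ n
                / (`|c| ^+ n.-1 * min_norm L ^+ n.-1))]).
Proof.
split; first exact: virtually_rectangular_decomposition.
by move=> C B dC uC dB _ isoL; exact: lattice_illumination isoL.
Qed.
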